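(* Let $\mathcal{T}=(S,\Sigma,\kappa)$ be a stochastic transition system. Let $B\in\Sigma$ be a measurable set, and let $A\in\Sigma$ be an attractor for $\mathcal{T}$. Let $\widetilde{B}=\{s\in S\mid \mathrm{Prob}^{\mathcal{T}}_{\delta_s}(\mathbf{F}\,B)=0\}$ be the avoid-set of $B$, and let $A' = A\cap (S\setminus\widetilde{B})$. Assume that there exists $p>0$ such that for all $\nu\in\mathrm{Dist}(A')$, $\mathrm{Prob}^{\mathcal{T}}_{\nu}(\mathbf{F}\,B)\ge p$. Then $\mathcal{T}$ is decisive with respect to $B$, i.e., for every $\mu\in\mathrm{Dist}(S)$, $\mathrm{Prob}^{\mathcal{T}}_{\mu}(\mathbf{F}\,B\lor\mathbf{F}\,\widetilde{B})=1$.
   Context: A stochastic transition system (STS) is a tuple $\mathcal{T}=(S,\Sigma,\kappa)$ where $(S,\Sigma)$ is a measurable space and $\kappa\colon S\times\Sigma\to[0,1]$ is a Markov kernel: for every $s\in S$, $\kappa(s,\cdot)$ is a probability measure, and for every $A\in\Sigma$, $\kappa(\cdot,A)$ is a measurable function. $\mathrm{Dist}(S)$ is the set of probability distributions on $(S,\Sigma)$; for $A\in\Sigma$, $\mathrm{Dist}(A)$ is the set of those probability distributions $\nu$ with $\nu(A)=1$. $\delta_s$ is the Dirac distribution at $s$. A run is an infinite sequence $s_0s_1s_2\ldots$ of states. For an initial distribution $\mu\in\mathrm{Dist}(S)$, $\mathrm{Prob}^{\mathcal{T}}_\mu$ is the unique probability measure on runs (on the $\sigma$-algebra generated by cylinders)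 under which $s_0$ has law $\mu$ and $s_{i+1}$ is drawn from $\kappa(s_i,\cdot)$. For $B\in\Sigma$, $\mathbf{F}\,B$ is the set of runs such that $s_i\in B$ for some $i\ge 0$. The avoid-set $\widetilde{B}$ belongs to $\Sigma$. A set $A\in\Sigma$ is an attractor for $\mathcal{T}$ if for every $\mu\in\mathrm{Dist}(S)$, $\mathrm{Prob}^{\mathcal{T}}_\mu(\mathbf{F}\,A)=1$. *)

(* Defs.v *)
From HB Require Import structures.
From mathcomp Require Import all_boot all_order all_algebra.
From mathcomp Require Import all_classical all_reals all_analysis measurable_realfun.

Set Implicit Arguments.
Unset Strict Implicit.
Unset Printing Implicit Defensive.
Import Order.TTheory GRing.Theory Num.Theory.
Import numFieldNormedType.Exports.
Local Open Scope classical_set_scope.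
Local Open Scope ring_scope.
Local Open Scope ereal_scope.

(* A stochastic transition system on S is a probability kernel kappa : R.-pker S ~> S;
   a run is a map nat -> S. *)
Section runs.
Context d (S : measurableType d).

Definition cylinder (As : seq (set S)) : set (nat -> S) :=
  [set r | forall i, (i < size As)%N -> nth setT As i (r i)].

Definition cylinders : set (set (nat -> S)) :=
  [set cylinder As | As in [set As | forall i, measurable (nth setT As i)]].

Definition runs : measurableType cylinders.-sigma :=
  g_sigma_algebraType cylinders.

Definition eventually_in (B : set S) : set runs :=
  [set r : runs | exists i, B (r i)].

Lemma measurable_cylinder As : (forall i, measurable (nth setT As i)) ->
  measurable (cylinder As : set runs).
Proof. by move=> mAs; apply: sub_sigma_algebra; exists As. Qed.

Lemma measurable_coord n : measurable_fun setT (fun r : runs => r n).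
Proof.
move=> _ A mA; rewrite setTI.
have -> : (fun r : runs => r n) @^-1` A = cylinder (rcons (nseq n setT) A).
  apply/seteqP; split=> r /= rA.
    move=> i; rewrite size_rcons size_nseq ltnS nth_rcons size_nseq nth_nseq.
    by rewrite leq_eqVlt => /predU1P[->|->//]; rewrite ltnn eqxx.
  have := rA n; rewrite size_rcons size_nseq ltnSn nth_rcons size_nseq ltnn.
  by rewrite eqxx; exact.
apply: measurable_cylinder => i.
by rewrite nth_rcons size_nseq nth_nseq; case: ifP => // _; case: ifP.
Qed.

Lemma measurable_fun_runs d' (T : measurableType d') (f : T -> runs) :
  (forall n, measurable_fun setT (fun t => f t n)) -> measurable_fun setT f.
Proof.
move=> mf; apply: (@measurability _ _ T runs setT f cylinders) => //.
move=> _ [_ [As mAs <-] <-]; rewrite setTI.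
have -> : f @^-1` cylinder As =
    \bigcap_(i in `I_(size As)) ((fun t => f t i) @^-1` nth setT As i) by [].
apply: bigcap_measurableType => i _.
by rewrite -[X in measurable X]setTI; exact: mf.
Qed.

Lemma cylinderI As Bs : cylinder As `&` cylinder Bs =
  cylinder (mkseq (fun i => nth setT As i `&` nth setT Bs i)
                  (maxn (size As) (size Bs))).
Proof.
have cylE Cs : cylinder Cs = [set r | forall i, nth setT Cs i (r i)].
  apply/seteqP; split=> r rC i; last by move=> _; exact: rC.
  by have [iC|iC] := ltnP i (size Cs); [exact: rC|rewrite nth_default].
rewrite !cylE; apply/seteqP; split=> r /=.
  move=> [rA rB] i.
  have [im|im] := ltnP i (maxn (size As) (size Bs)); first by rewrite nth_mkseq.
  by rewrite nth_default ?size_mkseq.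
move=> rAB; split=> i; have := rAB i;
  (have [im|] := ltnP i (maxn (size As) (size Bs));
    [by rewrite nth_mkseq// => -[]|]);
  by rewrite geq_max => /andP[? ?]; rewrite [in X in _ -> X]nth_default.
Qed.

End runs.

Section run_law.
Context d (S : measurableType d) (R : realType) (kappa : R.-pker S ~> S).

(* For As = [:: A0; ...; An], this is the iterated integral
   \int[nu]_(s0 in A0) \int[kappa s0]_(s1 in A1) ... \int[kappa s_(n-1)]_(sn in An) 1. *)
Fixpoint cylinder_weight (As : seq (set S)) (nu : {measure set S -> \bar R}) :
    \bar R :=
  if As is A :: As' then \int[nu]_(s in A) cylinder_weight As' (kappa s) else 1.

Definition is_run_law (mu : probability S R) (P : probability (runs S) R) :=
  forall As : seq (set S), (forall i, measurable (nth setT As i)) ->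
  P (cylinder As) = cylinder_weight As mu.

Lemma run_law_unique mu (P Q : probability (runs S) R) :
  is_run_law mu P -> is_run_law mu Q ->
  forall E, measurable E -> P E = Q E.
Proof.
move=> Pmu Qmu E mE.
apply: (@measure_unique _ R (runs S) (@cylinders _ S) (fun=> setT)) => //.
- move=> _ _ [As mAs <-] [Bs mBs <-]; rewrite cylinderI.
  eexists; last reflexivity.
  move=> i /=; have [im|im] := ltnP i (maxn (size As) (size Bs)).
    by rewrite nth_mkseq//; exact: measurableI.
  by rewrite nth_default ?size_mkseq.
- move=> _; exists [::]; first by move=> i /=; rewrite nth_nil.
  by apply/seteqP; split.
- by rewrite bigcup_const.
- by move=> _ [As mAs <-]; exact: etrans (Pmu _ mAs) (esym (Qmu _ mAs)).
- by move=> _; apply: (le_lt_trans (probability_le1 P measurableT)); rewrite ltry.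
Qed.

End run_law.

(* Existence of the law of runs (Ionescu-Tulcea). *)
Module IonescuTulcea.
Section existence.
Context d (S : measurableType d) (R : realType) (kappa : R.-pker S ~> S).
Variable mu : probability S R.
Local Notation runs := (runs S).

(* The law of the n-th coordinate given the previous ones. *)
Definition step n (r : runs) : {measure set S -> \bar R} :=
  if n is n'.+1 then kappa (r n') else mu.

Lemma step_setT n r : step n r setT = 1.
Proof.
by case: n => [|n] /=; [exact: probability_setT|exact: prob_kernel].
Qed.

Lemma measurable_step n U : measurable U ->
  measurable_fun setT (fun r : runs => step n r U).
Proof.
case: n => [|n] mU /=; first exact: measurable_cst.
exact: measurableT_comp (measurable_kernel kappa U mU) (measurable_coord n).
Qed.

HB.instance Definition _ n :=
  isKernel.Build _ _ _ _ _ (step n) (measurable_step n).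
HB.instance Definition _ n :=
  Kernel_isProbability.Build _ _ _ _ _ (step n) (step_setT n).

Definition upd (r : runs) n (s : S) : runs := fun i => if i == n then s else r i.

Definition depends T N (f : runs -> T) :=
  forall r r', (forall i, (i < N)%N -> r i = r' i) -> f r = f r'.

Lemma depends_le T M N (f : runs -> T) :
  (M <= N)%N -> depends M f -> depends N f.
Proof.
by move=> MN fM r r' rr'; apply: fM => i iM; apply: rr'; exact: leq_trans MN.
Qed.

(* J n integrates the n-th coordinate out. *)
Definition J n (f : runs -> \bar R) (r : runs) :=
  \int[step n r]_s f (upd r n s).

(* L k m integrates the coordinates k, ..., k + m - 1 out. *)
Fixpoint L k m (f : runs -> \bar R) : runs -> \bar R :=
  if m is m'.+1 then J k (L k.+1 m' f) else f.

Definition nnmfun (f : runs -> \bar R) :=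
  (forall r, 0 <= f r) /\ measurable_fun setT f.

Lemma measurable_upd n :
  measurable_fun setT (fun rs : runs * S => upd rs.1 n rs.2 : runs).
Proof.
apply: measurable_fun_runs => i; rewrite /upd; case: eqP => _.
  exact: measurable_snd.
exact: (measurableT_comp (measurable_coord i) measurable_fst).
Qed.

Lemma nnmfun_upd f n r : nnmfun f ->
  (forall s, 0 <= f (upd r n s)) /\ measurable_fun setT (fun s => f (upd r n s)).
Proof.
move=> [f0 mf]; split=> //.
have -> : (fun s => f (upd r n s)) =
    f \o ((fun rs : runs * S => upd rs.1 n rs.2) \o (fun s => (r, s))) by [].
apply: measurableT_comp => //; apply: measurableT_comp.
  exact: measurable_upd.
exact: measurable_pair1.
Qed.

Lemma nnmfunJ f n : nnmfun f -> nnmfun (J n f).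
Proof.
move=> [f0 mf]; split=> [r|]; first by apply: integral_ge0 => s _; exact: f0.
rewrite /J.
apply: (measurable_fun_integral_finite_kernel
  (fun rs : runs * S => f (upd rs.1 n rs.2)) (step n : R.-fker runs ~> S)) => //.
by apply: measurableT_comp => //; exact: measurable_upd.
Qed.

Lemma nnmfunL f k m : nnmfun f -> nnmfun (L k m f).
Proof.
by move=> nf; elim: m k => //= m IH k; exact/nnmfunJ/IH.
Qed.

Lemma dependsJ f n : depends n.+1 f -> depends n (J n f).
Proof.
move=> df r r' rr'; rewrite /J.
have -> : step n r = step n r' by case: n df rr' => //= n _ ->.
apply: eq_integral => s _; apply: df => i; rewrite ltnS /upd.
by case: eqP => // /eqP ni; rewrite leq_eqVlt (negbTE ni) => /= /rr'.
Qed.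

Lemma dependsL f N k m : depends N f -> (N <= k + m)%N -> depends k (L k m f).
Proof.
move=> df; elim: m k => [|m IH] k /=; first by rewrite addn0 => /depends_le; exact.
by rewrite addnS -addSn => /IH; exact: dependsJ.
Qed.

Lemma J_id f N k : depends N f -> (N <= k)%N -> J k f = f.
Proof.
move=> df Nk; apply/funext => r; rewrite /J.
under eq_integral => s _.
  have -> : f (upd r k s) = f r.
    apply: df => i iN; rewrite /upd ltn_eqF//; exact: leq_trans Nk.
  over.
by rewrite integral_cst// [X in _ * X]step_setT mule1.
Qed.

Lemma L_id f N k m : depends N f -> (N <= k)%N -> L k m f = f.
Proof.
move=> df; elim: m k => //= m IH k Nk.
by rewrite IH ?(leq_trans Nk)//; exact: J_id df Nk.
Qed.

Lemma L_eq f N k m m' : depends N f -> (N <= k + m)%N -> (N <= k + m')%N ->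
  L k m f = L k m' f.
Proof.
move=> df; elim: m m' k => [|m IH] [|m'] k //=.
- by rewrite addn0 => Nk _; rewrite -[RHS]/(L k m'.+1 f) (L_id _ df).
- by rewrite addn0 => _ Nk; rewrite -[LHS]/(L k m.+1 f) (L_id _ df).
- by rewrite !addnS -!addSn => Nm Nm'; rewrite (IH m').
Qed.

Lemma L_sum (f : nat -> runs -> \bar R) n k m : (forall i, nnmfun (f i)) ->
  L k m (fun r => \sum_(0 <= i < n) f i r) =
  (fun r => \sum_(0 <= i < n) L k m (f i) r).
Proof.
move=> nf; elim: m k => //= m IH k; rewrite IH; apply/funext => r.
rewrite /J ge0_integral_sum// => i.
  by have [] := nnmfun_upd k r (nnmfunL k.+1 m (nf i)).
by move=> x _; have [] := nnmfunL k.+1 m (nf i).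
Qed.

Lemma L_le f g k m : nnmfun f -> nnmfun g -> (forall r, f r <= g r) ->
  forall r, L k m f r <= L k m g r.
Proof.
move=> nf ng fg; elim: m k => //= m IH k r.
apply: ge0_le_integral => //.
- by move=> s _; have [] := nnmfunL k.+1 m nf.
- by have [] := nnmfun_upd k r (nnmfunL k.+1 m nf).
- by have [] := nnmfun_upd k r (nnmfunL k.+1 m ng).
Qed.

Lemma descent (e g : nat -> runs -> \bar R) r0 :
  (forall k, nnmfun (e k)) -> (forall k, nnmfun (g k)) ->
  (forall k, depends k (e k)) -> (forall k, depends k (g k)) ->
  (forall k, e k = J k (e k.+1)) -> (forall k, g k = J k (g k.+1)) ->
  g 0%N r0 < e 0%N r0 -> exists r, forall k, g k r < e k r.
Proof.
move=> ne ng de dg eJ gJ ge0.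
have next k r : exists s, g k r < e k r ->
    g k.+1 (upd r k s) < e k.+1 (upd r k s).
  have [lt|nlt] := pselect (g k r < e k r); last by exists point => /nlt.
  apply: contrapT => /forallNP h; move: lt; apply/negP; rewrite -leNgt.
  rewrite eJ gJ; apply: ge0_le_integral => //.
  - by move=> s _; have [] := ne k.+1.
  - by have [] := nnmfun_upd k r (ne k.+1).
  - by have [] := nnmfun_upd k r (ng k.+1).
  - by move=> s _; rewrite leNgt; apply/negP => lt; apply: (h s) => _.
have [c cP] : {c : nat -> runs -> S & forall k r, g k r < e k r ->
    g k.+1 (upd r k (c k r)) < e k.+1 (upd r k (c k r))}.
  exists (fun k r => projT1 (cid (next k r))) => k r.
  exact: (projT2 (cid (next k r))).
pose rho := fix rho k := if k is k'.+1 then upd (rho k') k' (c k' (rho k')) else r0.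
have rhoP k : g k (rho k) < e k (rho k) by elim: k => //= k; exact: cP.
have rho_stab i k : rho (i.+1 + k)%N i = rho i.+1 i.
  elim: k => [|k IH]; first by rewrite addn0.
  by rewrite addnS -IH /= {1}/upd ltn_eqF// addSn ltnS leq_addr.
exists (fun i => rho i.+1 i) => k.
have rr i : (i < k)%N -> rho i.+1 i = rho k i.
  by move=> ik; rewrite -(subnKC ik) rho_stab.
by rewrite (dg k _ (rho k))// (de k _ (rho k))//; exact: rhoP.
Qed.

Definition finitary : set (set runs) :=
  [set E | measurable E /\ exists N, depends N E].

(* An alias of runs carrying the algebra of finitary sets. *)
Definition falg : Type := runs.

Definition falg_display : measure_display. Proof. by constructor. Qed.

Lemma finitary0 : finitary set0. Proof. by split => //; exists 0%N. Qed.

Lemma finitaryC E : finitary E -> finitary (~` E).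
Proof.
move=> [mE [N dE]]; split; first exact: measurableC.
by exists N => r r' rr'; rewrite /setC/= (dE _ _ rr').
Qed.

Lemma finitaryU E F : finitary E -> finitary F -> finitary (E `|` F).
Proof.
move=> [mE [N dE]] [mF [M dF]]; split; first exact: measurableU.
exists (maxn N M) => r r' rr'; rewrite /setU/=.
rewrite (depends_le (leq_maxl N M) dE rr').
by rewrite (depends_le (leq_maxr N M) dF rr').
Qed.

HB.instance Definition _ := Pointed.on falg.
HB.instance Definition _ := @isAlgebraOfSets.Build falg_display falg
  finitary finitary0 finitaryU finitaryC.

Definition ind (E : set runs) (r : runs) : \bar R := (\1_E r)%:E.

Lemma nnmfun_ind E : measurable E -> nnmfun (ind E).
Proof.
move=> mE; split=> [r|]; first by rewrite lee_fin.
exact/measurable_EFinP/measurable_indic.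
Qed.

Lemma depends_ind (E : set runs) N : depends N E -> depends N (ind E).
Proof.
move=> dE r r' rr'; rewrite /ind !indicE.
by have -> : (r \in E) = (r' \in E) by apply/idP/idP; rewrite !inE (dE _ _ rr').
Qed.

Definition content (E : set falg) : \bar R :=
  L 0 (xget 0%N [set N | depends N E]) (ind E) point.

Lemma contentE E N : depends N E -> content E = L 0 N (ind E) point.
Proof.
move=> dE; rewrite /content; case: xgetP => [M _ /= dE'|/(_ N)//].
have [NM|MN] := leqP N M; first by rewrite (L_eq (m' := N) (depends_ind dE)).
by rewrite (L_eq (m' := N) (depends_ind dE'))// ltnW.
Qed.

Lemma content0 : content set0 = 0.
Proof. by rewrite (@contentE _ 0%N)//= /ind indic0. Qed.

Lemma content_ge0 E : 0 <= content E.
Proof.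
rewrite /content; case: (xget _ _) => [|n] /=; first by rewrite lee_fin.
apply: integral_ge0 => s _; elim: n 1%N (upd _ _ _) => [|n IH] k r /=.
  by rewrite lee_fin.
by apply: integral_ge0 => t _; exact: IH.
Qed.

Lemma content_sigma_additive : semi_sigma_additive content.
Proof.
move=> F mF tF [mU [N dU]].
have /choice[M dF] i : exists M, depends M (F i) by have [_] := mF i.
have mF' i : measurable (F i : set runs) by have [] := mF i.
pose U := \bigcup_i F i.
have nF i : nnmfun (ind (F i)) by exact: nnmfun_ind.
have nU : nnmfun (ind U) by exact: nnmfun_ind.
suff -> : content U = \sum_(0 <= i <oo) content (F i).
  by apply: is_cvg_nneseries => n _ _; exact: content_ge0.
apply/eqP; rewrite eq_le; apply/andP; split; last first.
  apply: lime_le; first by apply: is_cvg_nneseries => n _ _; exact: content_ge0.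
  apply: nearW => n.
  pose K := maxn N (\max_(i < n) M i).
  rewrite (@contentE U K); last exact: depends_le (leq_maxl _ _) dU.
  under eq_big_nat => i /andP[_ ni].
    rewrite (@contentE _ K); last first.
      apply: depends_le (dF i); apply: leq_trans (leq_maxr _ _).
      exact: (leq_bigmax (Ordinal ni)).
    over.
  rewrite -[X in X <= _](congr1 (@^~ _) (@L_sum (fun i => ind (F i)) n 0 K nF)).
  apply: L_le => //.
    split=> [r|]; first by apply: sume_ge0 => i _; exact: (nF i).1.
    by apply: emeasurable_sum => i; exact: (nF i).2.
  move=> r; rewrite /ind sumEFin lee_fin.
  have [[j Fjr]|nF'] := pselect (exists j, F j r); last first.
    rewrite big1 => [|i _]; first by [].
    by rewrite indicE memNset// => Fir; apply: nF'; exists i.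
  rewrite [leRHS]indicE mem_set; last by exists j.
  rewrite (eq_bigr (fun i => (if i == j then 1%N else 0%N)%:R)) => [|i _].
    rewrite -natr_sum ler_nat -big_mkcond sum1_count count_uniq_mem ?leq_b1//.
    exact: iota_uniq.
  rewrite indicE; case: eqP => [->|ij]; first by rewrite mem_set.
  rewrite memNset// => Fir; apply: ij.
  by apply: (tF i j) => //; exists r.
rewrite leNgt; apply/negP => lt.
pose e k := L k N (ind U).
pose f i k := L k (M i) (ind (F i)).
pose g k r := \sum_(0 <= i <oo) f i k r.
have nf i k : nnmfun (f i k) by exact: nnmfunL.
have [] := @descent e g point.
- by move=> k; exact: nnmfunL.
- move=> k; split=> [r|]; first by apply: nneseries_ge0 => i _ _; exact: (nf i k).1.
  apply: ge0_emeasurable_sum => [i r _ _|i _]; first exact: (nf i k).1.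
  exact: (nf i k).2.
- by move=> k; apply: (dependsL (depends_ind dU)); exact: leq_addl.
- move=> k r r' rr'; apply: eq_eseriesr => i _.
  by apply: (dependsL (depends_ind (dF i))) => //; exact: leq_addl.
- move=> k; rewrite /e -[RHS]/(L k N.+1 (ind U)).
  by apply: (L_eq (depends_ind dU)); rewrite ?leq_addl// addnS leqW// leq_addl.
- move=> k; apply/funext => r; rewrite /g /J integral_nneseries//; last 2 first.
  + by move=> i; have [] := nnmfun_upd k r (nf i k.+1).
  + by move=> i s _; exact: (nf i k.+1).1.
  apply: eq_eseriesr => i _; rewrite /f -[RHS]/(L k (M i).+1 (ind (F i)) r).
  rewrite (L_eq (m' := (M i).+1) (depends_ind (dF i)))// ?leq_addl//.
  by rewrite addnS leqW// leq_addl.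
- rewrite /e /g /f; move: lt; rewrite (contentE dU).
  by under eq_eseriesr do rewrite (contentE (dF _)).
move=> r gr.
have [Ur|nUr] := pselect (U r); last first.
  have := gr N; rewrite /e (L_id _ (depends_ind dU))// /ind indicE memNset//.
  by rewrite ltNge nneseries_ge0// => i _ _; exact: (nf i N).1.
have [i _ Fir] := Ur.
have := gr (maxn N (M i)); apply/negP; rewrite -leNgt.
rewrite /e (L_id _ (depends_ind dU)) ?leq_maxl// /ind indicE mem_set//.
apply: (@le_trans _ _ (f i (maxn N (M i)) r)).
  by rewrite /f (L_id _ (depends_ind (dF i))) ?leq_maxr// /ind indicE mem_set.
rewrite /g (nneseriesD1 (n := i))//; last by move=> j _; exact: (nf j _).1.
by rewrite leeDl// nneseries_ge0// => j _ _; exact: (nf j _).1.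
Qed.

HB.instance Definition _ := isMeasure.Build _ _ _ content
  content0 content_ge0 content_sigma_additive.

Lemma measurable_extension (E : set runs) :
  measurable E -> <<s (measurable : set (set falg)) >> E.
Proof.
apply: smallest_sub; first exact: smallest_sigma_algebra.
move=> _ [As mAs <-]; apply: sub_sigma_algebra; split.
  exact: measurable_cylinder.
exists (size As) => r r' rr'; apply: propext.
by split=> rA i iA; have := rA i iA; rewrite rr'.
Qed.

Definition runs_measure (E : set runs) : \bar R := measure_extension content E.

Lemma runs_measure0 : runs_measure set0 = 0.
Proof. exact: measure0. Qed.

Lemma runs_measure_ge0 E : 0 <= runs_measure E.
Proof. exact: measure_ge0. Qed.

Lemma runs_measure_sigma_additive : semi_sigma_additive runs_measure.
Proof.
move=> F mF tF mU; apply: (@measure_semi_sigma_additive _ _ _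
  (measure_extension content)) => // [i|]; exact: measurable_extension.
Qed.

HB.instance Definition _ := isMeasure.Build _ _ _ runs_measure
  runs_measure0 runs_measure_ge0 runs_measure_sigma_additive.

Lemma runs_measureE E N : measurable E -> depends N E ->
  runs_measure E = L 0 N (ind E) point.
Proof.
move=> mE dE; rewrite -(contentE dE) /runs_measure /measure_extension.
by apply: measurable_mu_extE; split=> //; exists N.
Qed.

Lemma runs_measure_setT : runs_measure setT = 1.
Proof.
by rewrite (@runs_measureE _ 0%N)//= /ind indicT.
Qed.

HB.instance Definition _ :=
  Measure_isProbability.Build _ _ _ runs_measure runs_measure_setT.

Lemma L_cylinder As Bs r :
  L (size As) (size Bs) (ind (cylinder (As ++ Bs))) r =
  ind (cylinder As) r * cylinder_weight kappa Bs (step (size As) r).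
Proof.
elim: Bs As r => [|B Bs IH] As r /=; first by rewrite cats0 mule1.
rewrite /J.
have E s : L (size As).+1 (size Bs) (ind (cylinder (As ++ B :: Bs)))
      (upd r (size As) s) =
    ind (cylinder As) r * ((fun s => cylinder_weight kappa Bs (kappa s)) \_ B) s.
  rewrite -cat_rcons -(size_rcons As B) IH size_rcons /= /upd eqxx /patch.
  have -> : ind (cylinder (rcons As B)) (upd r (size As) s) =
      ind (cylinder As) r * (if s \in B then 1 else 0).
    rewrite /ind !indicE; case: ifPn => [/set_mem|] sB.
      rewrite mule1; suff -> : (upd r (size As) s \in cylinder (rcons As B)) =
        (r \in cylinder As) by [].
      apply/idP/idP; rewrite !inE => rA i.
        move=> iA; have := rA i; rewrite size_rcons nth_rcons iA /upd ltn_eqF//.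
        by apply; exact: ltnW.
      rewrite size_rcons ltnS nth_rcons /upd leq_eqVlt.
      case/predU1P => [->|iA]; first by rewrite ltnn eqxx.
      by rewrite iA ltn_eqF//; exact: rA.
    rewrite mule0 memNset// => /(_ (size As)).
    rewrite size_rcons nth_rcons ltnn eqxx /upd eqxx => /(_ (ltnSn _)).
    by move/mem_set; apply/negP.
  by rewrite -muleA; case: ifPn => _; rewrite ?mul1e ?mul0e.
under eq_integral do rewrite E.
rewrite /ind indicE; case: (r \in _); last first.
  by under eq_integral do rewrite mul0e; rewrite integral0 mul0e.
by under eq_integral do rewrite mul1e; rewrite mul1e [RHS]integral_mkcond.
Qed.

Lemma runs_measure_law : is_run_law kappa mu runs_measure.
Proof.
move=> As mAs; rewrite /= (@runs_measureE _ (size As)).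
- rewrite (L_cylinder [::] As) /= /ind indicE mem_set ?mul1e//.
- exact: measurable_cylinder.
- move=> r r' rr'; apply: propext.
  by split=> rA i iA; have := rA i iA; rewrite rr'.
Qed.

End existence.
End IonescuTulcea.

Section stochastic_transition_system.
Context d (S : measurableType d) (R : realType) (kappa : R.-pker S ~> S).

Lemma run_law_exists (mu : probability S R) :
  exists P : probability (runs S) R, is_run_law kappa mu P.
Proof. by eexists; exact: (IonescuTulcea.runs_measure_law kappa mu). Qed.

Definition Prob (mu : probability S R) : probability (runs S) R :=
  projT1 (cid (run_law_exists mu)).

Lemma ProbP mu : is_run_law kappa mu (Prob mu).
Proof. exact: projT2 (cid (run_law_exists mu)). Qed.

Definition Dist (A : set S) (nu : probability S R) : Prop := nu A = 1.

Definition attractor (A : set S) : Prop :=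
  forall mu : probability S R, Prob mu (eventually_in A) = 1.

Definition avoid_set (B : set S) : set S :=
  [set s | Prob \d_s (eventually_in B) = 0].

Definition decisive (B : set S) : Prop :=
  forall mu : probability S R,
    Prob mu (eventually_in B `|` eventually_in (avoid_set B)) = 1.

End stochastic_transition_system.

(* Main.v *)
(* Let C be the complement of the union of B and its avoid-set, and let u s be the
   probability, starting from s, of staying in C forever.  On the attractor A, either
   u vanishes (on the avoid-set) or u <= 1 - p.  Averaging over the first visit to A
   extends this bound to all states.  Applying it after n steps spent in C and letting
   n go to infinity gives u <= (1 - p) u, hence u = 0.  As p may exceed 1 when no
   distribution is carried by A', 1 - p is replaced by q = max 0 (1 - p). *)
Require Import Defs.
From HB Require Import structures.
From mathcomp Require Import all_boot all_order all_algebra.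
From mathcomp Require Import all_classical all_reals all_analysis measurable_realfun.
From mathcomp Require Import lra.

Set Implicit Arguments.
Unset Strict Implicit.
Unset Printing Implicit Defensive.
Import Order.TTheory GRing.Theory Num.Theory.
Import numFieldNormedType.Exports.
Local Open Scope classical_set_scope.
Local Open Scope ring_scope.
Local Open Scope ereal_scope.

Section staying.
Context d (S : measurableType d) (R : realType) (kappa : R.-pker S ~> S).
Implicit Types (C : set S) (m : {measure set S -> \bar R}).

Definition always_in C : set (runs S) := [set r : runs S | forall i, C (r i)].

Lemma eventually_inC C : ~` eventually_in C = always_in (~` C).
Proof.
by apply/seteqP; split=> r /= rC => [i Ci|[i Ci]]; [apply: rC; exists i|exact: (rC i)].
Qed.

Lemma eventually_inU C D :
  eventually_in (C `|` D) = eventually_in C `|` eventually_in D.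
Proof.
apply/seteqP; split=> r /=; first by move=> [i [?|?]]; [left|right]; exists i.
by move=> [[i ?]|[i ?]]; exists i; [left|right].
Qed.

Lemma eventually_in_bigcup C :
  eventually_in C = \bigcup_i ((fun r : runs S => r i) @^-1` C).
Proof. by apply/seteqP; split=> r /= [i]; [exists i|move=> _ Ci; exists i]. Qed.

Lemma measurable_eventually_in C : measurable C -> measurable (eventually_in C).
Proof.
move=> mC; rewrite eventually_in_bigcup; apply: bigcupT_measurable => i.
by rewrite -[X in measurable X]setTI; exact: measurable_coord.
Qed.

(** [is_run_law] prescribes only the probabilities of cylinders, so staying forever is reached
    through a decreasing sequence of them. *)
Lemma always_in_bigcap C :
  always_in C = \bigcap_n (cylinder (nseq n C) : set (runs S)).
Proof.
apply/seteqP; split=> r /= rC.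
  by move=> n _ i; rewrite size_nseq nth_nseq => ->.
move=> i; have := rC i.+1 I i.
by rewrite size_nseq nth_nseq ltnSn; exact.
Qed.

Lemma measurable_nth_nseq C n : measurable C ->
  forall i, measurable (nth setT (nseq n C) i).
Proof. by move=> mC i; rewrite nth_nseq; case: ifP. Qed.

Lemma measurable_always_in C : measurable C -> measurable (always_in C).
Proof.
move=> mC; rewrite always_in_bigcap; apply: bigcapT_measurable => n.
exact: measurable_cylinder (measurable_nth_nseq n mC).
Qed.

(* The probability, starting from s, that the first n states lie in C. *)
Fixpoint stay C n : S -> \bar R :=
  if n is n'.+1 then (fun s => \int[kappa s]_t stay C n' t) \_ C else cst 1.

(** Normalization enters at the empty cylinder: its weight is 1 by convention, while the integral of
    [stay C 0] is the total mass of [m]. *)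
Lemma cylinder_weight_stay C n m : m setT = 1 ->
  cylinder_weight kappa (nseq n C) m = \int[m]_s stay C n s.
Proof.
elim: n m => [|n IH] m m1 /=; first by rewrite integral_cst// m1 mule1.
by rewrite -integral_mkcond; apply: eq_integral => s _; rewrite IH// prob_kernel.
Qed.

Lemma stay_ge0 C n s : 0 <= stay C n s.
Proof.
elim: n s => [|n IH] s //=.
by rewrite /patch; case: ifP => // _; apply: integral_ge0 => t _.
Qed.

Lemma measurable_stay C n : measurable C -> measurable_fun setT (stay C n).
Proof.
move=> mC; elim: n => [|n IH] /=; first exact: measurable_cst.
apply/(measurable_restrictT _ mC); apply: measurable_funTS.
apply: measurable_fun_integral_kernel => // [U mU|s]; last exact: stay_ge0.
exact: measurable_kernel.
Qed.

Lemma stay_le1 C n s : measurable C -> stay C n s <= 1.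
Proof.
move=> mC; elim: n s => [|n IH] s //=.
rewrite /patch; case: ifP => // _.
apply: (@le_trans _ _ (\int[kappa s]_t cst 1 t)); last first.
  by rewrite integral_cst// prob_kernel mule1.
by apply: ge0_le_integral => // [t _|]; [exact: stay_ge0|exact: measurable_stay].
Qed.

Lemma Prob_cylinder C n (mu : probability S R) : measurable C ->
  Prob kappa mu (cylinder (nseq n C)) = \int[mu]_s stay C n s.
Proof.
move=> mC; rewrite (ProbP kappa mu (measurable_nth_nseq n mC)).
by rewrite cylinder_weight_stay; last exact: probability_setT.
Qed.

(** Continuity from above along the cylinders of [always_in_bigcap]. *)
Lemma cvg_Prob_always_in C (mu : probability S R) : measurable C ->
  (fun n => \int[mu]_s stay C n s) @ \oo --> Prob kappa mu (always_in C).
Proof.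
move=> mC; under eq_fun do rewrite -Prob_cylinder//.
rewrite always_in_bigcap; apply: nonincreasing_cvg_mu.
- rewrite (le_lt_trans (probability_le1 _ _)) ?ltry//.
  exact: measurable_cylinder (measurable_nth_nseq 0 mC).
- by move=> n; exact: measurable_cylinder (measurable_nth_nseq n mC).
- by rewrite -always_in_bigcap; exact: measurable_always_in.
- move=> n k nk; apply/subsetPset => r rC i.
  rewrite size_nseq nth_nseq => ni; rewrite ni.
  have ik := leq_trans ni nk.
  by have := rC i; rewrite size_nseq nth_nseq ik; exact.
Qed.

Definition stay_forever C s : \bar R :=
  Prob kappa (\d_s : probability S R) (always_in C).

Lemma stay_forever_ge0 C s : 0 <= stay_forever C s.
Proof. exact: measure_ge0. Qed.

Lemma stay_forever_le1 C s : measurable C -> stay_forever C s <= 1.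
Proof. by move=> mC; apply: probability_le1; exact: measurable_always_in. Qed.

Lemma cvg_stay C s : measurable C ->
  (fun n => stay C n s) @ \oo --> stay_forever C s.
Proof.
move=> mC; have := @cvg_Prob_always_in C (\d_s : probability S R) mC.
suff E n : \int[\d_s]_t stay C n t = stay C n s by under eq_fun do rewrite E.
by rewrite integral_dirac ?diracT ?mul1e//; exact: measurable_stay.
Qed.

Lemma measurable_stay_forever C : measurable C ->
  measurable_fun setT (stay_forever C).
Proof.
move=> mC; apply: (emeasurable_fun_cvg (stay C)) => [n|s _].
  exact: measurable_stay.
exact: cvg_stay.
Qed.

(** Dominated convergence, with the constant 1 as dominating function. *)
Lemma cvg_integral_stay C m : measurable C -> m setT = 1 ->
  (fun n => \int[m]_s stay C n s) @ \oo --> \int[m]_s stay_forever C s.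
Proof.
move=> mC m1; apply: (dominated_cvg measurableT (f_ := stay C) (g := cst 1)) => //.
- by move=> n; exact: measurable_stay.
- by move=> s _; exact: cvg_stay.
- apply/integrableP; split=> //.
  under eq_integral do rewrite /= normr1.
  by rewrite integral_cst// m1 mule1 ltry.
- by move=> n s _; rewrite gee0_abs ?stay_ge0// stay_le1.
Qed.

(** Both sides are limits of the same sequence. This reduces an arbitrary initial law to Dirac
    ones. *)
Lemma Prob_always_in C (mu : probability S R) : measurable C ->
  Prob kappa mu (always_in C) = \int[mu]_s stay_forever C s.
Proof.
move=> mC; rewrite -(cvg_lim _ (cvg_Prob_always_in (mu := mu) mC))//.
by apply: cvg_lim => //; apply: cvg_integral_stay => //; exact: probability_setT.
Qed.

(** The first-step equation: the limit of the recursion that defines [stay]. *)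
Lemma stay_foreverE C : measurable C ->
  stay_forever C = (fun s => \int[kappa s]_t stay_forever C t) \_ C.
Proof.
move=> mC; apply/funext => s.
have : (fun n => stay C n.+1 s) @ \oo --> stay_forever C s.
  by have := @cvg_stay C s mC; rewrite -cvg_shiftS.
move/cvg_lim => <- //=; apply: cvg_lim => //.
rewrite /patch; case: ifP => sC; last exact: cvg_cst.
by apply: cvg_integral_stay => //; exact: prob_kernel.
Qed.

Lemma stay_forever_dirac_eventually_in D s : measurable D ->
  Prob kappa (\d_s : probability S R) (eventually_in D) =
  1 - stay_forever (~` D) s.
Proof.
move=> mD; have mE := measurable_eventually_in mD.
rewrite -[in LHS](setCK (eventually_in D)) probability_setC; last exact: measurableC.
by rewrite eventually_inC.
Qed.

Lemma measurable_avoid_set B : measurable B -> measurable (avoid_set kappa B).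
Proof.
move=> mB.
(* The avoid-set is a level set of a measurable function: never meeting [B] is almost sure exactly
   on it. *)
have -> : avoid_set kappa B = stay_forever (~` B) @^-1` [set 1].
  apply/seteqP; split=> s; rewrite /avoid_set/= stay_forever_dirac_eventually_in//.
    by move/eqP; rewrite sube_eq ?fin_num_adde_defr// add0e => /eqP.
  by move=> ->; rewrite subee.
rewrite -[X in measurable X]setTI.
by apply: measurable_stay_forever => //; exact: measurableC.
Qed.

(* Off A, the first-step equation bounds u s by the kappa s-average of u; inductively,
   u s <= q + (probability of missing A for n steps), and the error tends to 0. *)
Lemma stay_forever_le_attractor A C (q : \bar R) :
  measurable A -> measurable C -> attractor kappa A -> 0 <= q ->
  (forall s, A s -> stay_forever C s <= q) -> forall s, stay_forever C s <= q.
Proof.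
move=> mA mC hA q0 Aq.
have mA' := measurableC mA.
have bound n s : stay_forever C s <= q + stay (~` A) n s.
  elim: n s => [|n IH] s /=.
    by rewrite (le_trans (stay_forever_le1 s mC))// leeDr.
  have [As|nAs] := pselect (A s).
    by rewrite (le_trans (Aq _ As))// leeDl// (stay_ge0 _ n.+1).
  have sA' : s \in ~` A by exact: mem_set.
  rewrite stay_foreverE// /patch sA'.
  (* Outside [C] the left side is 0, so the average bounds it in either case. *)
  apply: (@le_trans _ _ (\int[kappa s]_t stay_forever C t)).
    case: ifP => // _; exact: integral_ge0.
  apply: (@le_trans _ _ (\int[kappa s]_t (q + stay (~` A) n t))).
    apply: ge0_le_integral => //.
    - exact: measurable_stay_forever.
    - by apply: emeasurable_funD => //; exact: measurable_stay.
  rewrite ge0_integralD//.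
  - by rewrite integral_cst// prob_kernel mule1.
  - by move=> t _; exact: stay_ge0.
  - exact: measurable_stay.
move=> s.
(* The attractor property at the Dirac law makes the error term vanish in the limit. *)
have A0 : stay_forever (~` A) s = 0.
  rewrite /stay_forever -eventually_inC probability_setC ?hA ?subee//.
  exact: measurable_eventually_in.
have cv : (fun n => q + stay (~` A) n s) @ \oo --> q + 0.
  apply: cvgeD; [by rewrite fin_num_adde_defl|exact: cvg_cst|].
  by rewrite -A0; exact: cvg_stay.
rewrite -(adde0 q) -(cvg_lim _ cv)//; apply: lime_ge; first exact: cvgP cv.
by apply: nearW => n; exact: bound.
Qed.

(* The bound u <= q at the state reached after n steps in C gives u <= q * stay C n;
   letting n go to infinity, u <= q u. *)
Lemma stay_forever_eq0 C (q : R) : measurable C -> (0 <= q < 1)%R ->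
  (forall s, stay_forever C s <= q%:E) -> forall s, stay_forever C s = 0.
Proof.
move=> mC /andP[q0 q1] uq s.
have bound n t : stay_forever C t <= q%:E * stay C n t.
  elim: n t => [|n IH] t /=; first by rewrite mule1.
  (* Outside [C] both sides are 0; inside, the induction hypothesis is integrated against
     [kappa t]. *)
  rewrite stay_foreverE// /patch; case: ifP => tC; last by rewrite mule0.
  rewrite -ge0_integralZl ?lee_fin//; last 2 first.
  - exact: measurable_stay.
  - by move=> r _; exact: stay_ge0.
  apply: ge0_le_integral => //.
  - exact: measurable_stay_forever.
  - by apply: measurable_funeM; exact: measurable_stay.
have uqu : stay_forever C s <= q%:E * stay_forever C s.
  have cv : (fun n => q%:E * stay C n s) @ \oo --> q%:E * stay_forever C s.
    by apply: cvgeZl => //; exact: cvg_stay.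
  rewrite -(cvg_lim _ cv)//; apply: lime_ge; first exact: cvgP cv.
  by apply: nearW => n; exact: bound.
have ufin : stay_forever C s \is a fin_num.
  by rewrite fin_num_measure//; exact: measurable_always_in.
have u0 := stay_forever_ge0 C s.
move: uqu u0; rewrite -(fineK ufin) -EFinM !lee_fin => uqu u0.
(* For a finite nonnegative u, u <= q u with q < 1 forces u = 0. *)
by congr EFin; apply/eqP; rewrite eq_le u0 andbT; nra.
Qed.

End staying.

Theorem proposition2p8 (R : realType) (d : measure_display)
    (S : measurableType d) (kappa : R.-pker S ~> S) (A B : set S)
    (mB : measurable B) (mA : measurable A) (hA : attractor kappa A)
    (hp : exists p : R, (0 < p)%R /\
      forall nu : probability S R, Dist (A `&` ~` avoid_set kappa B) nu ->
        p%:E <= Prob kappa nu (eventually_in B)) :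
  decisive kappa B.
Proof.
move: hp => [p [p0 hp]] mu; rewrite -eventually_inU.
have mBt := measurable_avoid_set kappa mB.
set D := B `|` avoid_set kappa B.
have mD : measurable D by exact: measurableU.
have mD' := measurableC mD.
pose q : R := (Num.max 0 (1 - p))%R.
have q01 : (0 <= q < 1)%R by rewrite /q le_max lexx/= gt_max ltr01/=; lra.
suff u0 s : stay_forever kappa (~` D) s = 0.
  have : Prob kappa mu (~` eventually_in D) = 0.
    by rewrite eventually_inC Prob_always_in// (eq_integral (cst 0)) ?integral0.
  have mE := measurable_eventually_in mD.
  rewrite probability_setC// => /eqP.
  by rewrite sube_eq ?fin_num_adde_defr// add0e => /eqP.
apply: (stay_forever_eq0 mD' q01) => {}s.
apply: (stay_forever_le_attractor mA mD' hA) => [|{}s As].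
  by rewrite lee_fin; case/andP: q01.
have [sBt|nsBt] := pselect (avoid_set kappa B s).
  (* A state of the avoid-set lies in [D], so staying in the complement of [D] fails at time 0. *)
  rewrite stay_foreverE// patchN ?lee_fin; first by case/andP: q01.
  by apply/negP; rewrite inE; apply; right.
have : p%:E <= Prob kappa (\d_s : probability S R) (eventually_in D).
  (* Here [s] is in [A] but not in the avoid-set, so its Dirac law is carried by A' and the
     hypothesis applies to it. *)
  apply: (le_trans (hp \d_s _)).
    by rewrite /Dist/= diracE mem_set.
  rewrite /D eventually_inU; apply: le_measure; rewrite ?inE.
  - exact: measurable_eventually_in.
  - by apply: measurableU; exact: measurable_eventually_in.
  - exact: subsetUl.
rewrite stay_forever_dirac_eventually_in//.
have : stay_forever kappa (~` D) s \is a fin_num.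
  by rewrite fin_num_measure//; exact: measurable_always_in.
move/fineK <-; rewrite -EFinB !lee_fin /q le_max => pu.
by apply/orP; right; lra.
Qed.
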